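(* Let $k$ be a kernel whose support is $S=\{\pm2^l: l\in\mathbb{N}_0\}$, let $S_+=S\cap\mathbb{N}$, and assume that $$\sum_{l\in S_+}\Big(\frac{k(2l)}{k(l)}\Big)^2<\infty.$$ Then the corresponding operator $\mathcal{L}$ satisfies $CD(0,d)$ for some finite $d>0$.
   Context: $\mathbb{N}=\{1,2,\dots\}$, $\mathbb{N}_0=\mathbb{N}\cup\{0\}$. A kernel is a function $k:\mathbb{Z}\to[0,\infty)$ with $k(0)=0$, $k(-j)=k(j)$ for all $j\in\mathbb{N}$, and $0<|k|_1:=\sum_{j\in\mathbb{Z}}k(j)<\infty$; its support is $\{j\in\mathbb{Z}:k(j)\ne0\}$. The associated operator is $\mathcal{L}u(x)=\sum_{j\in\mathbb{Z}}k(j)\big(u(x+j)-u(x)\big)$, $x\in\mathbb{Z}$, and the iterated carré du champ operator is given by $\Gamma_2(u)(x)=\frac14\sum_{j,l\in\mathbb{Z}}k(j)k(l)\big(u(x+j+l)-u(x+j)-u(x+l)+u(x)\big)^2\in[0,\infty]$. A function $u:\mathbb{Z}\to\mathbb{R}$ is admissible for $CD(0,d)$ at $x\in\mathbb{Z}$ if $\sum_{j\in\mathbb{Z}}k(j)|u(x+j)|<\infty$. For $d\in(0,\infty)$, $\mathcal{L}$ satisfies $CD(0,d)$ if $\Gamma_2(u)(x)\ge\frac1d\big(\mathcal{L}u(x)\big)^2$ for every $x\in\mathbb{Z}$ and every $u$ admissible at $x$. *)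

(* Defs.v *)
From mathcomp Require Import all_boot all_order all_algebra.
From mathcomp Require Import all_classical all_reals all_analysis.

Set Implicit Arguments.
Unset Strict Implicit.
Unset Printing Implicit Defensive.

Import Order.TTheory GRing.Theory Num.Theory.

Local Open Scope classical_set_scope.
Local Open Scope ring_scope.

Definition norm1 (R : realType) (k : int -> R) : \bar R :=
  (\esum_(j in [set: int]) (k j)%:E)%E.

Record is_kernel (R : realType) (k : int -> R) : Prop := IsKernel {
  kernel_ge0 : forall j, 0 <= k j;
  kernel0 : k 0 = 0;
  kernelN : forall j, k (- j) = k j;
  kernel_norm1_gt0 : (0 < norm1 k)%E;
  kernel_norm1_lty : (norm1 k < +oo)%E }.

Definition ksupp (R : realType) (k : int -> R) : set int :=
  [set j | k j != 0].

(* Sum of an absolutely convergent real family indexed by int. [esum] is only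
   meaningful on nonnegative families, hence the split into positive and
   negative parts. The value is meaningless if [f] is not absolutely
   summable. *)
Definition zsum (R : realType) (f : int -> R) : R :=
  fine (\esum_(j in [set: int]) (EFin \o f)^\+ j)%E
  - fine (\esum_(j in [set: int]) (EFin \o f)^\- j)%E.

(* If [k] is a kernel and [u] is admissible at [x], then the defining family
   is absolutely summable, since k is; L is only used in that case. *)
Definition Lop (R : realType) (k u : int -> R) (x : int) : R :=
  zsum (fun j => k j * (u (x + j) - u x)).

Definition Gamma2 (R : realType) (k u : int -> R) (x : int) : \bar R :=
  ((4^-1)%:E * \esum_(p in [set: int * int])
    (k p.1 * k p.2
     * (u (x + p.1 + p.2) - u (x + p.1) - u (x + p.2) + u x) ^+ 2)%:E)%E.

Definition admissible (R : realType) (k u : int -> R) (x : int) : Prop :=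
  (\esum_(j in [set: int]) (k j * `|u (x + j)|)%:E < +oo)%E.

Definition CD0 (R : realType) (k : int -> R) (d : R) : Prop :=
  forall (x : int) (u : int -> R), admissible k u x ->
    ((d^-1 * Lop k u x ^+ 2)%:E <= Gamma2 k u x)%E.

(* Main.v *)
Require Import Defs.
From mathcomp Require Import all_boot all_order all_algebra.
From mathcomp Require Import all_classical all_reals all_analysis.
From mathcomp Require Import ring lra zify.

(** Write [w l = k(2^l)] and let [a l = u(x+2^l) + u(x-2^l) - 2u(x)] be the
    symmetric second difference at scale [2^l], so that [L u(x)] is the series
    of the [w l * a l].  Among the nonnegative terms of [Gamma_2], only those
    with steps [(j,j)] and [(j,-j)] are kept ([Gamma2_ge]).

    The steps [(j,-j)] control [w_l^2 a_l^2] in sum, which alone does not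
    bound a plain sum such as [L u(x)].  The support is closed under
    doubling, and that is what helps: the steps [(2^l,2^l)] and [(-2^l,-2^l)]
    produce one-sided second differences [b] and [c] whose sum is
    [a_{l+1} - 2 a_l], so the weight of scale [l] also controls the difference
    at the next scale, that is, [w_l^2 a_{l+1}^2] in sum.  Writing
    [w_{l+1} a_{l+1} = (w_{l+1}/w_l) * (w_l a_{l+1})], the Cauchy-Schwarz
    inequality and the square summability of the ratios bound the series by the
    square root of [Gamma_2] ([weighted_sum_bound]).

    Only finite sums meet Cauchy-Schwarz; the passage to [L u(x)] is the limit
    of dyadic partial sums ([Lop_cvg]). *)

Import Order.TTheory GRing.Theory Num.Theory.
Import numFieldNormedType.Exports.

Local Open Scope classical_set_scope.
Local Open Scope ring_scope.

(** * Cauchy-Schwarz and sums over the dyadic integers *)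

Lemma CauchySchwarz_sum (R : realFieldType) (f g : nat -> R) (n : nat) :
  (\sum_(0 <= i < n) f i * g i) ^+ 2 <=
  (\sum_(0 <= i < n) f i ^+ 2) * (\sum_(0 <= i < n) g i ^+ 2).
Proof.
elim: n => [|n IHn]; first by rewrite !big_geq// expr0n /= mulr0.
rewrite !big_nat_recr//=.
set S := \sum_(_ <= _ < _) _ in IHn *.
set A := \sum_(_ <= _ < _) _ in IHn *.
set B := \sum_(_ <= _ < _) _ in IHn *.
have A0 : 0 <= A by apply: sumr_ge0 => i _; exact: sqr_ge0.
have B0 : 0 <= B by apply: sumr_ge0 => i _; exact: sqr_ge0.
have T0 : 0 <= f n ^+ 2 * B + A * g n ^+ 2.
  by rewrite addr_ge0// mulr_ge0// sqr_ge0.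
(* The cross term: an AM-GM inequality combined with the induction
   hypothesis S^2 <= A B. *)
have cross : 2 * S * (f n * g n) <= f n ^+ 2 * B + A * g n ^+ 2.
  apply: (le_trans (ler_norm _)); rewrite -(ger0_norm T0) -ler_sqr ?nnegrE//.
  rewrite !real_normK ?num_real//.
  have fg : S ^+ 2 * (f n * g n) ^+ 2 <= A * B * (f n * g n) ^+ 2.
    by rewrite ler_wpM2r ?sqr_ge0.
  have := sqr_ge0 (f n ^+ 2 * B - A * g n ^+ 2); nra.
by nra.
Qed.

Definition dyadic : set int :=
  [set j : int | exists l : nat, j = 2 ^+ l \/ j = - 2 ^+ l].

Lemma exp2_inj : injective (fun l : nat => 2 ^+ l : int).
Proof. by move=> m n; apply: ieexprIn. Qed.

Lemma dyadic_neq0 (j : int) : dyadic j -> j != 0.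
Proof. by move=> [l [->|->]]; rewrite ?oppr_eq0 expf_neq0. Qed.

Lemma dyadic_gt0 : dyadic `&` [set j | 0 < j] = range (fun l : nat => 2 ^+ l).
Proof.
apply/seteqP; split => [j [[l [->|->]]] /=|_ [l _ <-]]; first by exists l.
  by rewrite oppr_gt0 ltNge exprn_ge0.
by split; [exists l; left|rewrite /= exprn_gt0].
Qed.

Lemma dyadic_le0 :
  dyadic `&` ~` [set j | 0 < j] = range (fun l : nat => - 2 ^+ l).
Proof.
apply/seteqP; split => [j [[l [->|->]]] /=|_ [l _ <-]].
- by rewrite exprn_gt0.
- by exists l.
- by split; [exists l; right|rewrite /= oppr_gt0 ltNge exprn_ge0].
Qed.

Lemma esum_dyadic (R : realType) (F : int -> \bar R) :
  (forall j, 0 <= F j)%E -> (forall j, ~ dyadic j -> F j = 0%E) ->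
  (\esum_(j in [set: int]) F j =
   \sum_(0 <= l <oo) (F (2 ^+ l)%R + F (- 2 ^+ l)%R))%E.
Proof.
move=> F0 FD.
have -> : (\esum_(j in [set: int]) F j = \esum_(j in dyadic) F j)%E.
  rewrite [RHS]esum_mkcond; apply: eq_esum => j _.
  by case: ifPn => // /negP; rewrite inE => /FD.
rewrite (esumID [set j | 0 < j])// dyadic_gt0 dyadic_le0.
have rangeE e : injective e ->
    (\esum_(i in range e) F i = \sum_(0 <= l <oo) F (e l))%E.
  by move=> e_inj; rewrite esum_image ?nneseries_esumT// => m n _ _ /e_inj.
have opp_inj : injective (fun l : nat => - 2 ^+ l : int).
  by move=> m n /oppr_inj; exact: exp2_inj.
by rewrite (rangeE _ exp2_inj) (rangeE _ opp_inj) nneseriesD.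
Qed.

Lemma esum_ge_pair (R : realType) (T : choiceType) (a : T -> \bar R) (s t : T) :
  (forall i, 0 <= a i)%E -> s != t ->
  (a s + a t <= \esum_(i in [set: T]) a i)%E.
Proof.
move=> a0 st; rewrite (esumID [set s])// setTI esum_set1//.
apply: leeD2l; rewrite (esumID [set t])// setTI.
have -> : ~` [set s] `&` [set t] = [set t].
  by apply/seteqP; split => [i []//|_ ->]; split => //= /esym/eqP; exact/negP.
by rewrite esum_set1// leeDl// esum_ge0.
Qed.

Lemma cvg_nneseries_fine (R : realType) (f : nat -> R) :
  (forall l, 0 <= f l) -> (\sum_(0 <= l <oo) (f l)%:E < +oo)%E ->
  \sum_(0 <= l < n) f l @[n --> \oo] --> fine (\sum_(0 <= l <oo) (f l)%:E)%E.
Proof.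
move=> f0 foo.
have f0E l : (0 <= (f l)%:E)%E by rewrite lee_fin.
have cf := @is_cvg_nneseries R (EFin \o f) xpredT 0%N (fun n _ _ => f0E n).
have ffin : (\sum_(0 <= l <oo) (f l)%:E)%E \is a fin_num.
  by rewrite ge0_fin_numE// nneseries_ge0.
have /fine_cvgP[_] : (fun n => \sum_(0 <= l < n) (f l)%:E)%E @ \oo -->
    (fine (\sum_(0 <= l <oo) (f l)%:E)%E)%:E.
  by rewrite fineK.
by apply: cvg_trans; apply: near_eq_cvg; near=> n; rewrite /= sumEFin.
Unshelve. all: end_near. Qed.

(** The signed sum is assembled from the positive and negative parts, for which
    grouping the terms [2^l] and [-2^l] is free; subtracting afterwards gives
    the convergence of the grouped series, in which the symmetric differences
    appear. *)
Lemma zsum_dyadic (R : realType) (f : int -> R) :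
  (forall j, ~ dyadic j -> f j = 0) ->
  (\esum_(j in [set: int]) `|f j|%:E < +oo)%E ->
  \sum_(0 <= l < n) (f (2 ^+ l) + f (- 2 ^+ l)) @[n --> \oo] --> zsum f.
Proof.
move=> fD foo.
pose P j : R := Num.max (f j) 0; pose N j : R := Num.max (- f j) 0.
have P0 j : 0 <= P j by rewrite /P le_max lexx orbT.
have N0 j : 0 <= N j by rewrite /N le_max lexx orbT.
have PE j : ((EFin \o f)^\+ j = (P j)%:E)%E by rewrite funeposE /P /= -EFin_max.
have NE j : ((EFin \o f)^\- j = (N j)%:E)%E by rewrite funenegE /N /= -EFin_max.
have PD j : ~ dyadic j -> P j = 0 by move=> /fD; rewrite /P => ->; rewrite maxxx.
have ND j : ~ dyadic j -> N j = 0.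
  by move=> /fD; rewrite /N => ->; rewrite oppr0 maxxx.
have Poo : (\esum_(j in [set: int]) (P j)%:E < +oo)%E.
  apply: le_lt_trans foo; apply: le_esum => j _.
  by rewrite lee_fin ge_max ler_norm normr_ge0.
have Noo : (\esum_(j in [set: int]) (N j)%:E < +oo)%E.
  apply: le_lt_trans foo; apply: le_esum => j _.
  by rewrite lee_fin ge_max normr_ge0 -normrN ler_norm.
rewrite /zsum (eq_esum (fun j _ => PE j)) (eq_esum (fun j _ => NE j)).
have sumE (g : int -> R) (g0 : forall j, 0 <= g j)
    (gD : forall j, ~ dyadic j -> g j = 0) :
    (\esum_(j in [set: int]) (g j)%:E =
     \sum_(0 <= l <oo) (g (2 ^+ l) + g (- 2 ^+ l))%:E)%E.
  by rewrite (esum_dyadic _ (EFin \o g)) => [|j|j /gD /= ->] //; rewrite lee_fin.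
rewrite sumE// in Poo *; rewrite sumE// in Noo *.
have cP := cvg_nneseries_fine _ _ (fun l => addr_ge0 (P0 _) (P0 _)) Poo.
have cN := cvg_nneseries_fine _ _ (fun l => addr_ge0 (N0 _) (N0 _)) Noo.
have -> : (fun n => \sum_(0 <= l < n) (f (2 ^+ l) + f (- 2 ^+ l))) =
  (fun n => \sum_(0 <= l < n) (P (2 ^+ l) + P (- 2 ^+ l))) \-
  (fun n => \sum_(0 <= l < n) (N (2 ^+ l) + N (- 2 ^+ l))).
  apply/funext => n /=; rewrite -sumrB; apply: eq_bigr => l _.
  have fE j : f j = P j - N j by rewrite /P /N; case: (lerP (f j) 0); case: (lerP (- f j) 0); lra.
  by rewrite !fE; ring.
exact: cvgB.
Qed.

(** * The discrete operators on dyadic steps *)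

Definition symdiff {R : realType} (u : int -> R) (x : int) (l : nat) : R :=
  u (x + 2 ^+ l) + u (x - 2 ^+ l) - 2 * u x.

(** The contribution to [4 Gamma_2 / k(2^l)^2] of the four steps [(j,j)] and
    [(j,-j)] with [j = 2^l] or [j = -2^l]; the two steps [(j,-j)] contribute
    equally, whence the factor 2. *)
Definition energy {R : realType} (u : int -> R) (x : int) (l : nat) : R :=
  (u (x + 2 ^+ l.+1) - 2 * u (x + 2 ^+ l) + u x) ^+ 2
  + (u (x - 2 ^+ l.+1) - 2 * u (x - 2 ^+ l) + u x) ^+ 2
  + 2 * symdiff u x l ^+ 2.

Lemma symdiff_le_energy (R : realType) (u : int -> R) (x : int) (l : nat) :
  2 * symdiff u x l ^+ 2 <= energy u x l.
Proof. by rewrite lerDr addr_ge0// sqr_ge0. Qed.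

Lemma energy_ge0 (R : realType) (u : int -> R) (x : int) (l : nat) :
  0 <= energy u x l.
Proof.
apply: le_trans (symdiff_le_energy _ _ _ _).
by apply: mulr_ge0 => //; exact: sqr_ge0.
Qed.

(** The step to the next scale: with [b] and [c] the two one-sided second
    differences, [a_{l+1} = b + c + 2 a_l], and
    [(b + c + 2a)^2 <= 4 (b^2 + c^2 + 2a^2)] by Cauchy-Schwarz. *)
Lemma symdiffS_le_energy (R : realType) (u : int -> R) (x : int) (l : nat) :
  symdiff u x l.+1 ^+ 2 <= 4 * energy u x l.
Proof.
rewrite /energy.
set b := u (x + 2 ^+ l.+1) - 2 * _ + _.
set c := u (x - 2 ^+ l.+1) - 2 * _ + _.
set a := symdiff u x l.
have -> : symdiff u x l.+1 = b + c + 2 * a by rewrite /symdiff /b /c /a /symdiff; ring.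
have := sqr_ge0 (b - c); have := sqr_ge0 (b - a).
by have := sqr_ge0 (c - a); nra.
Qed.

(** All terms of [Gamma_2] are nonnegative, so restricting the double sum to
    the steps [(j,j)] and [(j,-j)] can only decrease it. *)
Lemma Gamma2_ge (R : realType) (k u : int -> R) (x : int) :
  (forall j, 0 <= k j) -> (forall j, k (- j) = k j) ->
  (forall j, ~ dyadic j -> k j = 0) ->
  (\sum_(0 <= l <oo) (k (2 ^+ l) ^+ 2 * energy u x l)%:E <= 4%:E * Gamma2 k u x)%E.
Proof.
move=> k0 kN kD.
rewrite /Gamma2 muleA -EFinM divff// mul1e.
set G := fun p : int * int => k p.1 * k p.2 *
  (u (x + p.1 + p.2) - u (x + p.1) - u (x + p.2) + u x) ^+ 2.
have G0 p : 0 <= G p by apply: mulr_ge0 (sqr_ge0 _); exact: mulr_ge0.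
have GD i j : ~ dyadic i -> G (i, j) = 0 by move=> /kD; rewrite /G /= => ->; ring.
have -> : [set: int * int] = [set: int] `*`` (fun=> [set: int]).
  by apply/seteqP; split.
rewrite -(@esum_esum R int int setT (fun=> setT) (fun i j => (G (i, j))%:E));
  last by move=> *; rewrite lee_fin.
apply: (@le_trans _ _
    (\esum_(i in [set: int]) ((G (i, i))%:E + (G (i, - i)%R)%:E))%E); last first.
  apply: le_esum => i _; have [->|i0] := eqVneq i 0.
    have D0 : ~ dyadic 0 by move=> /dyadic_neq0/eqP.
    by rewrite !(GD 0)// adde0 esum_ge0// => j _; rewrite lee_fin.
  apply: (@esum_ge_pair R int (fun j => (G (i, j))%:E)).
    by move=> j; rewrite lee_fin.
  by apply/eqP => /esym; move: i0 => /eqP; lia.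
rewrite esum_dyadic.
- apply: lee_nneseries => [l _ _|l _]; rewrite -?EFinD lee_fin.
    by apply: mulr_ge0 (energy_ge0 _ _ _ _); exact: sqr_ge0.
  rewrite /energy /symdiff /G /= opprK !kN !addrK !subrK.
  have -> : x + 2 ^+ l + 2 ^+ l = x + 2 ^+ l.+1 :> int by rewrite exprS; ring.
  have -> : x - 2 ^+ l - 2 ^+ l = x - 2 ^+ l.+1 :> int by rewrite exprS; ring.
  by rewrite le_eqVlt; apply/orP; left; apply/eqP; ring.
- by move=> j; rewrite -EFinD lee_fin addr_ge0.
- by move=> j jD; rewrite !GD// adde0.
Qed.

(** The heart of the estimate, with [e] standing for the energies.  The first
    term of the sum has no predecessor and is bounded on its own; every later
    term borrows the weight of the preceding scale, and [2 * 4 * C * M] comes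
    from Cauchy-Schwarz after splitting [(h + t)^2 <= 2 h^2 + 2 t^2]. *)
Lemma weighted_sum_bound (R : realFieldType) (w a e : nat -> R) (C M : R) (n : nat) :
  (forall l, 0 < w l) ->
  (forall m, \sum_(0 <= l < m) (w l.+1 / w l) ^+ 2 <= C) ->
  (forall m, \sum_(0 <= l < m) w l ^+ 2 * e l <= M) ->
  (forall l, 2 * a l ^+ 2 <= e l) ->
  (forall l, a l.+1 ^+ 2 <= 4 * e l) ->
  (\sum_(0 <= l < n) w l * a l) ^+ 2 <= (1 + 8 * C) * M.
Proof.
move=> w0 wC eM ae ae'.
have e0 l : 0 <= e l by apply: le_trans (ae l); rewrite mulr_ge0 ?sqr_ge0.
have C0 : 0 <= C by have := wC 0%N; rewrite big_geq.
have M0 : 0 <= M by have := eM 0%N; rewrite big_geq.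
case: n => [|n].
  by rewrite big_geq// expr0n /= mulr_ge0// addr_ge0// mulr_ge0.
rewrite big_nat_recl//=.
have head : 2 * (w 0%N * a 0%N) ^+ 2 <= M.
  apply: le_trans (eM 1%N); rewrite big_nat1 exprMn mulrCA.
  by rewrite ler_wpM2l ?sqr_ge0.
have tail : (\sum_(0 <= l < n) w l.+1 * a l.+1) ^+ 2 <= C * (4 * M).
  have -> : \sum_(0 <= l < n) w l.+1 * a l.+1 =
      \sum_(0 <= l < n) (w l.+1 / w l) * (w l * a l.+1).
    by apply: eq_bigr => l _; rewrite mulrA divfK// gt_eqF.
  apply: le_trans (CauchySchwarz_sum _ _ _ _) _.
  apply: ler_pM => //; try by apply: sumr_ge0 => l _; exact: sqr_ge0.
  apply: le_trans (ler_wpM2l _ (eM n)) => //.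
  rewrite mulr_sumr; apply: ler_sum => l _.
  by rewrite exprMn [leRHS]mulrCA ler_wpM2l ?sqr_ge0.
set h := w 0%N * a 0%N in head *.
set t := \sum_(_ <= _ < _) _ in tail *.
by have := sqr_ge0 (h - t); nra.
Qed.

(** Admissibility and the integrability of [k] make the family defining the
    operator absolutely summable; the symmetry of [k] merges the steps [2^l]
    and [-2^l] into [symdiff]. *)
Lemma Lop_cvg (R : realType) (k u : int -> R) (x : int) :
  is_kernel k -> (forall j, ~ dyadic j -> k j = 0) -> admissible k u x ->
  \sum_(0 <= l < n) k (2 ^+ l) * symdiff u x l @[n --> \oo] --> Lop k u x.
Proof.
move=> hk kD adm.
have k0 := kernel_ge0 hk.
have kc (c : R) : 0 <= c -> (\esum_(j in [set: int]) (k j * c)%:E < +oo)%E.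
  move=> c0; have := kernel_norm1_lty hk; rewrite /norm1.
  rewrite (esum_dyadic _ (fun j => (k j)%:E)) => [|j|j /kD->]//; last first.
    by rewrite lee_fin.
  rewrite (esum_dyadic _ (fun j => (k j * c)%:E)); last 2 first.
  - by move=> j; rewrite lee_fin mulr_ge0.
  - by move=> j /kD->; rewrite mul0r.
  move=> koo.
  under eq_eseriesr do rewrite -EFinD -mulrDl mulrC EFinM EFinD.
  rewrite nneseriesZl; last by move=> l _; rewrite adde_ge0// lee_fin.
  by rewrite lte_mul_pinfty.
have -> : (fun n => \sum_(0 <= l < n) k (2 ^+ l) * symdiff u x l) =
    (fun n => \sum_(0 <= l < n) (k (2 ^+ l) * (u (x + 2 ^+ l) - u x)
      + k (- 2 ^+ l) * (u (x - 2 ^+ l) - u x))).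
  by apply/funext => n; apply: eq_bigr => l _; rewrite /symdiff kernelN//; ring.
apply: (zsum_dyadic R (fun j => k j * (u (x + j) - u x))).
  by move=> j /kD ->; rewrite mul0r.
have := lte_add_pinfty adm (kc _ (normr_ge0 (u x))).
rewrite -esumD => [|j _|j _]; try by rewrite lee_fin mulr_ge0.
apply: le_lt_trans; apply: le_esum => j _.
by rewrite -EFinD lee_fin normrM (ger0_norm (k0 j)) -mulrDr ler_wpM2l// ler_normB.
Qed.

(** * The curvature-dimension inequality *)

Theorem theorem5p1 (R : realType) (k : int -> R) (hk : is_kernel k)
  (hS : ksupp k = [set j : int | exists l : nat, j = 2 ^+ l \/ j = - 2 ^+ l])
  (hsum : (\esum_(l in ksupp k `&` [set l : int | (0 < l)%R])
             (((k (2 * l) / k l) ^+ 2)%R)%:E < +oo)%E) :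
  exists d : R, 0 < d /\ CD0 k d.
Proof.
have k0 := kernel_ge0 hk.
have kD j : ~ dyadic j -> k j = 0.
  by rewrite /dyadic -hS /ksupp /= => /negP; rewrite negbK => /eqP.
pose w l : R := k (2 ^+ l).
have w0 l : 0 < w l.
  rewrite lt_neqAle eq_sym k0 andbT.
  have : ksupp k (2 ^+ l) by rewrite hS; exists l; left.
  by [].
pose r l := (w l.+1 / w l) ^+ 2.
have r0 l : (0 <= (r l)%:E)%E by rewrite lee_fin sqr_ge0.
move: hsum; rewrite hS -/dyadic dyadic_gt0.
rewrite esum_image; last by move=> m n _ _ /exp2_inj.
under eq_esum do rewrite -exprS.
rewrite -(@nneseries_esumT _ (EFin \o r))// => roo.
pose C := fine (\sum_(0 <= l <oo) (r l)%:E)%E.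
have rC n : \sum_(0 <= l < n) r l <= C.
  rewrite -lee_fin fineK; last by rewrite ge0_fin_numE// nneseries_ge0.
  by rewrite -sumEFin; exact: nneseries_lim_ge.
have C0 : 0 <= C by have := rC 0%N; rewrite big_geq.
have d0 : 0 < 4 * (1 + 8 * C) by nra.
exists (4 * (1 + 8 * C)); split => // x u adm.
have G0 : (0 <= Gamma2 k u x)%E.
  apply: mule_ge0; first by rewrite lee_fin invr_ge0.
  apply: esum_ge0 => p _; rewrite lee_fin.
  by apply: mulr_ge0 (sqr_ge0 _); exact: mulr_ge0.
have := @Gamma2_ge R k u x k0 (kernelN hk) kD.
(* If Gamma_2 is infinite at x there is nothing to prove. *)
case: (Gamma2 k u x) G0 => [g|_ _|//]; last by rewrite leey.
rewrite lee_fin => g0; rewrite -EFinM lee_fin ler_pdivrMl//.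
move=> Gge.
have eM n : \sum_(0 <= l < n) w l ^+ 2 * energy u x l <= 4 * g.
  rewrite -lee_fin -sumEFin; apply: le_trans Gge.
  apply: nneseries_lim_ge => l _ _; rewrite lee_fin.
  by apply: mulr_ge0 (energy_ge0 _ _ _ _); exact: sqr_ge0.
have Lcvg := @Lop_cvg R k u x hk kD adm.
have L2cvg := cvgM (FF := eventually_filter) Lcvg Lcvg.
rewrite expr2 -(cvg_lim _ L2cvg)//.
apply: limr_le; first by apply: cvgP L2cvg.
apply: nearW => n; rewrite /= -expr2.
apply: le_trans (weighted_sum_bound _ _ _ _ _ _ n w0 rC eM
  (symdiff_le_energy _ u x) (symdiffS_le_energy _ u x)) _.
by nra.
Qed.
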